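(* There is a constant $C>0$ such that, for every integer $n\ge 3$ and every $\tau\in\mathcal{A}_n$, $$\kappa(\tau)\ge n-C\sqrt n\,\log n.$$
   Context: $\mathcal{A}_n$ denotes the set of triangulations of a convex $n$-gon (using only the $n$ vertices of the polygon), $n\ge 3$. Slopes are elements of $\mathbb{Q}\cup\{\infty\}$, written $\frac pq$ with $p,q$ coprime integers (up to overall sign), $\infty=\frac10$; the intersection number of slopes is $\iota\left(\frac pq,\frac ab\right)=|pb-qa|$. The Farey complex $\mathcal{F}$ is the simplicial complex with vertex set $\mathbb{Q}\cup\{\infty\}$ in which a set of slopes spans a simplex exactly when its elements pairwise have intersection number $1$. Each triangulation $\tau\in\mathcal{A}_n$ has a dual trivalent planar tree with $n$ leaves; the vertices of the polygon correspond to the maximal paths in this tree all of whose turns are in one direction (all left or all right), called the horoballs of $\tau$. Thus $\tau$ has $n$ horoballs, in bijection with the $n$ vertices of the polygon. Every $\tau\in\mathcal{A}_n$ can be realized as a subcomplex of $\mathcal{F}$ (orientation-preservingly), uniquely up to the action of $\mathrm{PSL}(2,\mathbb{Z})$ on $\mathcal{F}$ by simplicial automorphisms; the resulting injective map from the horoballs (polygon vertices) of $\tau$ to $\mathbb{Q}\cup\{\infty\}$ is called a Farey labelling. The intersection number $\iota(H_1,H_2)$ of two horoballs of $\tau$ is the intersection number of their slopes in a Farey labelling; it does not depend on the labelling. Finally, $$\kappa(\tau)=\max\{\iota(H_1,H_2): H_1,H_2 \text{ horoballs of }\tau\}.$$ *)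

(* Defs.v *)
From mathcomp Require Import all_boot all_order all_algebra.
From mathcomp Require Import boolp classical_sets.

Set Implicit Arguments.
Unset Strict Implicit.
Unset Printing Implicit Defensive.

Import Order.TTheory GRing.Theory Num.Theory.

(* The vertices of the convex n-gon are the elements of 'I_n, listed in
   counterclockwise order.  The chord joining two vertices is represented by
   the pair (i, j) with i < j. *)

Definition polygon_side n (e : 'I_n * 'I_n) : bool :=
  (e.1.+1 == e.2 :> nat) || ((e.1 == 0 :> nat) && (e.2.+1 == n)).

Definition diagonal n (e : 'I_n * 'I_n) : bool := (e.1 < e.2) && ~~ polygon_side e.

Definition crossing n (e d : 'I_n * 'I_n) : bool :=
  (e.1 < d.1 < e.2) && (e.2 < d.2) || (d.1 < e.1 < d.2) && (d.2 < e.2).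

Definition noncrossing_diagonals n (D : {set 'I_n * 'I_n}) : bool :=
  [forall e in D, diagonal e] && [forall e in D, forall d in D, ~~ crossing e d].

(* Diagonals cut the polygon into triangles exactly when they form a maximal
   noncrossing family. *)
Definition triangulations n : {set {set 'I_n * 'I_n}} :=
  [set D | maxset (@noncrossing_diagonals n) D].

Definition edge n (D : {set 'I_n * 'I_n}) (e : 'I_n * 'I_n) : bool := polygon_side e || (e \in D).

(* The simplices of the complex of a triangulation are its vertices, its edges
   and its triangles; since the n points are in convex position, the triangles
   are exactly the triples of pairwise adjacent vertices. *)
Definition simplex n (D : {set 'I_n * 'I_n}) (A : {set 'I_n}) : bool :=
  (A != finset.set0) &&
  [forall i in A, forall j in A, (i < j) ==> edge D (i, j)].

(* Q u {oo}, with None standing for oo = 1/0. *)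
Definition slope : Type := option rat.

Section Slopes.
Local Open Scope ring_scope.
Implicit Types s t u : slope.

Definition snum s : int := if s is Some r then numq r else 1.
Definition sden s : int := if s is Some r then denq r else 0.

Definition sdet s t : int := snum s * sden t - sden s * snum t.

Definition slope_iota s t : nat := `|sdet s t|%N.

Definition farey_simplex (A : set slope) : Prop :=
  forall s t, A s -> A t -> s <> t -> slope_iota s t = 1%N.

(* The product does not depend on the signs chosen for numerators and
   denominators; it is positive for (0, 1, oo), and for s < t < u in Q. *)
Definition slope_ccw s t u : bool := 0 < sdet s t * sdet t u * sdet u s.

End Slopes.

Local Open Scope classical_set_scope.

Definition farey_labelling n (tau : {set 'I_n * 'I_n})
    (f : {ffun 'I_n -> option rat}) : Prop :=
  [/\ injective f,
      forall A : {set 'I_n}, simplex tau A -> farey_simplex (f @` [set` A]) &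
      forall i j k : 'I_n, i < j < k -> simplex tau [set i; j; k]%SET ->
        slope_ccw (f i) (f j) (f k)].

(* Some Farey labelling of tau.  The default value (the constant labelling oo,
   for which all intersection numbers vanish) is only taken when tau has no
   Farey labelling. *)
Definition farey_label n (tau : {set 'I_n * 'I_n}) :
    {ffun 'I_n -> option rat} :=
  xget [ffun=> None] [set f | farey_labelling tau f].

(* Horoballs are identified with the vertices of the polygon. *)
Definition horoball_iota n (tau : {set 'I_n * 'I_n}) (h1 h2 : 'I_n) : nat :=
  slope_iota (farey_label tau h1) (farey_label tau h2).

Definition kappa n (tau : {set 'I_n * 'I_n}) : nat :=
  \max_(h1 < n) \max_(h2 < n) horoball_iota tau h1 h2.

(* Main.v *)
(** A Farey labelling turns the n polygon vertices into n primitive vectors of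
    Z^2, distinct up to sign, whose pairwise determinants are at most
    k = kappa(tau) in absolute value, k being attained.  Thue's pigeonhole
    argument applied to a pair of determinant k gives a primitive linear form
    bounded by 2 sqrt k on all the vectors; take it as the height y.

    Let the slopes x/y of the vectors of height y lie in [s - a_y, s + b_y],
    where s is the slope of a vector of maximal height h.  By the sieve of
    Legendre there are at most phi(y) (a_y + b_y) + d(y) of them.  The bound on
    the determinants gives a_y + b_z <= k/(yz).  Summing this over the pairs
    (y, z) of consecutive denominators of the Farey sequence of order h, in
    which y occurs phi(y) times on either side, and for which the gaps 1/(yz)
    add up to 1, yields sum_y phi(y) (a_y + b_y) <= k.  Hence
    n <= 1 + k + sum_(y <= h) d(y) with h <= 2 sqrt k. *)

Require Import Defs.
From mathcomp Require Import all_boot all_order all_algebra.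
From mathcomp Require Import boolp classical_sets reals exp.
From mathcomp Require Import zify ring lra.

Set Implicit Arguments.
Unset Strict Implicit.
Unset Printing Implicit Defensive.

Import Order.TTheory GRing.Theory Num.Theory.

(** * Farey labellings of triangulations *)

Lemma triangulation_noncrossing (n : nat) (tau : {set 'I_n * 'I_n}) e d :
  tau \in triangulations n -> e \in tau -> d \in tau -> ~~ crossing e d.
Proof.
rewrite inE => /maxsetp /andP[_ /forall_inP H] et dt.
by have /forall_inP := H e et; apply.
Qed.

Lemma edges_noncrossing (n : nat) (tau : {set 'I_n * 'I_n})
    (a b c d : 'I_n) : tau \in triangulations n ->
  edge tau (a, b) -> edge tau (c, d) -> a < c -> c < b -> b < d -> False.
Proof.
rewrite /edge /polygon_side /= => tauT Hab Hcd ac cb bd.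
have dn := ltn_ord d.
have {}Hab : (a, b) \in tau by case/orP: Hab => // /orP[/eqP|/andP[_ /eqP]]; lia.
have {}Hcd : (c, d) \in tau by case/orP: Hcd => // /orP[/eqP|/andP[/eqP]]; lia.
have := triangulation_noncrossing tauT Hab Hcd.
by rewrite /crossing /= ac cb bd.
Qed.

(** Adding a diagonal that crosses no member keeps the family noncrossing, so maximality of [tau]
    forces it to be a member already. *)
Lemma edge_of_noncrossing (n : nat) (tau : {set 'I_n * 'I_n}) (a b : 'I_n) :
  tau \in triangulations n -> Defs.diagonal (a, b) ->
  (forall d, d \in tau -> ~~ crossing (a, b) d) -> (a, b) \in tau.
Proof.
rewrite inE => /maxsetP[/andP[/forall_inP H1 /forall_inP H2] Hmax] dab H.
suff <- : (a, b) |: tau = tau by rewrite setU11.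
apply: Hmax; last by rewrite finset.subsetUr.
have csym e d : @crossing n e d = crossing d e by rewrite /crossing orbC.
have cxx e : @crossing n e e = false by rewrite /crossing ltnn.
apply/andP; split; apply/forall_inP => e.
  by move=> /finset.setU1P[->|/H1].
move=> He; apply/forall_inP => d Hd.
case/finset.setU1P: He => [->|He]; case/finset.setU1P: Hd => [->|Hd]; rewrite ?cxx ?H //.
  by rewrite csym H.
by have /forall_inP := H2 e He; apply.
Qed.

Lemma edge_apex (n : nat) (tau : {set 'I_n * 'I_n}) (i j : 'I_n) :
  tau \in triangulations n -> edge tau (i, j) -> i.+1 < j ->
  exists k : 'I_n, [/\ i < k, k < j, edge tau (i, k) & edge tau (k, j)].
Proof.
move=> tauT Hij ij; have jn := ltn_ord j.
have i1n : i.+1 < n by lia.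
pose P (k : 'I_n) := [&& i < k, k < j & edge tau (i, k)].
have P0 : P (Ordinal i1n) by rewrite /P /= ltnSn ij /edge /polygon_side /= eqxx.
(* The third vertex is the last neighbour k of i before j: a diagonal crossing
   (k, j) would cross (i, j) or (i, k), or join i to a vertex beyond k. *)
case: (arg_maxnP (fun k : 'I_n => k : nat) P0) => k /and3P[ik kj Hik] kmax.
exists k; split=> //; rewrite /edge.
case: (boolP (polygon_side (k, j))) => //= nside.
apply: (edge_of_noncrossing tauT); first by rewrite /Defs.diagonal /= kj.
move=> [a b] Hab.
have Eab : edge tau (a, b) by rewrite /edge Hab orbT.
apply/negP; rewrite /crossing /= => /orP[]/andP[/andP[h1 h2] h3].
  by apply: (edges_noncrossing tauT Hij Eab); lia.
have [ai|ia|ia] := ltngtP a i.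
- by apply: (edges_noncrossing tauT Eab Hij); lia.
- by apply: (edges_noncrossing tauT Hik Eab).
have ea : a = i by apply: val_inj.
have := kmax b; rewrite /P -{2}ea Eab; lia.
Qed.

(** A pair [(p, q)] stands for the slope p/q. The sign is chosen so that the determinant is positive
    when the slope of [w] exceeds that of [u]. *)
Definition vdet (u w : nat * nat) : int := (w.1%:Z * u.2%:Z - u.1%:Z * w.2%:Z)%R.

(** The apex of the triangle on [(i, j)] receives the mediant [u + w], of determinant 1 with both
    [u] and [w], and the recursion continues on the two shorter edges. That labels are nonnegative
    combinations of [u] and [w] is what makes determinants across the apex positive. *)
Lemma mediant_labelling (n : nat) (tau : {set 'I_n * 'I_n})
    (i j : 'I_n) (u w : nat * nat) :
  tau \in triangulations n -> edge tau (i, j) -> i < j -> vdet u w = 1%R ->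
  exists v : nat -> nat * nat,
    [/\ v i = u, v j = w,
        forall a, i <= a <= j -> exists c d : nat,
          v a = (c * u.1 + d * w.1, c * u.2 + d * w.2)%N,
        forall a b, i <= a -> a < b -> b <= j -> (0 < vdet (v a) (v b))%R &
        forall a b : 'I_n, i <= a -> a < b -> b <= j -> edge tau (a, b) ->
          vdet (v a) (v b) = 1%R].
Proof.
move=> tauT; have [l] := ubnP (j - i)%N; elim: l i j u w => // l IH i j u w lt Hij ij uw.
have [jE|ij1] := leqP j i.+1.
  exists (fun a => if a == i :> nat then u else w); split.
  - by rewrite eqxx.
  - by case: eqP => //; lia.
  - move=> a _; case: eqP => _; [exists 1%N, 0%N|exists 0%N, 1%N].
      by rewrite !mul1n !mul0n !addn0; case: (u).
    by rewrite !mul1n !mul0n !add0n; case: (w).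
  - move=> a b ia ab bj; rewrite ifT ?ifF ?uw //; lia.
  - move=> a b ia ab bj _; rewrite ifT ?ifF ?uw //; lia.
have [k [ik kj Hik Hkj]] := edge_apex tauT Hij ij1.
pose s := (u.1 + w.1, u.2 + w.2)%N.
have us : vdet u s = 1%R by move: uw; rewrite /vdet /s /= !PoszD; nia.
have sw : vdet s w = 1%R by move: uw; rewrite /vdet /s /= !PoszD; nia.
have [|v1 [v1i v1k v1c v1p v1e]] := IH i k u s _ Hik ik us; first by lia.
have [|v2 [v2k v2j v2c v2p v2e]] := IH k j s w _ Hkj kj sw; first by lia.
pose v a := if a <= k then v1 a else v2 a.
have vl a : a <= k -> v a = v1 a by rewrite /v => ->.
have vr a : k <= a -> v a = v2 a.
  rewrite /v => ka; case: leqP => // ak; have -> : a = k by lia.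
  by rewrite v1k.
exists v; split.
- by rewrite vl // ltnW.
- by rewrite vr // ltnW.
- move=> a /andP[ia aj]; have [ak|ka] := leqP a k.
    have [|c [d E]] := v1c a; first by rewrite ia.
    exists (c + d)%N, d; rewrite vl // E; congr (_, _); rewrite /s /=; nia.
  have [|c [d E]] := v2c a; first by rewrite ltnW.
  exists c, (c + d)%N; rewrite vr ?(ltnW ka) // E; congr (_, _); rewrite /s /=; nia.
- move=> a b ia ab bj.
  have [bk|kb] := leqP b k; first by rewrite !vl ?v1p //; lia.
  have [ka|ak] := leqP k a; first by rewrite !vr ?v2p //; lia.
  (* Here a < k < b. With [v a = c u + d s] and [v b = c' s + d' w], the determinants against [s]
     are [c] and [d'], hence positive, and the one sought is [c c' + c d' + d d']. *)
  have [|c [d E]] := v1c a; first by lia.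
  have [|c' [d' E']] := v2c b; first by lia.
  have Pa : (0 < vdet (v1 a) s)%R by rewrite -v1k; apply: v1p.
  have Pb : (0 < vdet s (v2 b))%R by rewrite -v2k; apply: v2p.
  clearbody s; move: Pa Pb; rewrite vl ?(ltnW ak) // vr ?(ltnW kb) // E E'.
  have -> : vdet (c * u.1 + d * s.1, c * u.2 + d * s.2) s = (c%:Z * vdet u s)%R.
    by rewrite /vdet /= !PoszD !PoszM; ring.
  have -> : vdet s (c' * s.1 + d' * w.1, c' * s.2 + d' * w.2) = (d'%:Z * vdet s w)%R.
    by rewrite /vdet /= !PoszD !PoszM; ring.
  have -> : vdet (c * u.1 + d * s.1, c * u.2 + d * s.2)
              (c' * s.1 + d' * w.1, c' * s.2 + d' * w.2) =
      (c%:Z * c'%:Z * vdet u s + c%:Z * d'%:Z * vdet u w + d%:Z * d'%:Z * vdet s w)%R.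
    by rewrite /vdet /= !PoszD !PoszM; ring.
  rewrite us uw sw !mulr1.
  nia.
- move=> a b ia ab bj Hab.
  have [bk|kb] := leqP b k; first by rewrite !vl ?v1e //; lia.
  have [ka|ak] := leqP k a; first by rewrite !vr ?v2e //; lia.
  (* An edge straddling [k] crosses [(i, k)] or [(k, j)] unless it is [(i, j)] itself. *)
  have [ai|ai] := leqP a i; last by case: (edges_noncrossing tauT Hik Hab).
  have [jb|jb] := leqP j b; last first.
    by case: (edges_noncrossing tauT Hab Hkj); lia.
  have -> : a = i by apply: val_inj => /=; lia.
  have -> : b = j by apply: val_inj => /=; lia.
  by rewrite vl ?(ltnW ik) // vr ?(ltnW kj) // v1i v2j.
Qed.

(** * From integer vectors to Farey labellings by slopes *)

Local Open Scope ring_scope.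

Definition slope_of (v : nat * nat) : slope :=
  if v.2 == 0%N then None else Some (v.1%:Q / v.2%:Q).

Lemma slope_ofK v : coprime v.1 v.2 ->
  snum (slope_of v) = v.1%:Z /\ sden (slope_of v) = v.2%:Z.
Proof.
case: v => a b /=; rewrite /slope_of /=.
case: eqVneq => [->|b0] ab /=.
  by move: ab; rewrite /coprime gcdn0 => /eqP ->.
rewrite coprimeq_num // coprimeq_den //.
have bz : b%:Z != 0 by [].
by rewrite (negPf bz) gtr0_sg ?mul1r // ltz_nat lt0n.
Qed.

Lemma sdet_slope_of u v : coprime u.1 u.2 -> coprime v.1 v.2 ->
  sdet (slope_of u) (slope_of v) = - vdet u v.
Proof.
move=> /slope_ofK[un ud] /slope_ofK[vn vd].
by rewrite /sdet un ud vn vd /vdet; ring.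
Qed.

Lemma vdet1_coprime u v : vdet u v = 1 -> coprime u.1 u.2 /\ coprime v.1 v.2.
Proof.
rewrite /vdet => E; split.
  change (coprimez u.1 u.2); apply/coprimezP.
  by exists (- v.2%:Z, v.1%:Z) => /=; rewrite -E; ring.
change (coprimez v.1 v.2); apply/coprimezP.
by exists (u.2%:Z, - u.1%:Z) => /=; rewrite -E; ring.
Qed.

Lemma farey_labelling_exists n (tau : {set 'I_n * 'I_n}) : (1 < n)%N ->
  tau \in triangulations n -> exists f, farey_labelling tau f.
Proof.
case: n tau => [//|n] tau n1 tauT.
have side0 : edge tau (ord0, ord_max) by rewrite /edge /polygon_side /= eqxx orbT.
(* The side joining the first and last vertices gets the slopes 0 and oo. *)
have [v [_ _ _ vpos ve]] := @mediant_labelling _ _ ord0 ord_max (0, 1)%N (1, 0)%N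
  tauT side0 n1 erefl.
have {}vpos (a b : 'I_n.+1) : (a < b)%N -> 0 < vdet (v a) (v b).
  by move=> ab; apply: vpos => //; rewrite -ltnS.
have {}ve (a b : 'I_n.+1) : (a < b)%N -> edge tau (a, b) -> vdet (v a) (v b) = 1.
  by move=> ab; apply: ve => //; rewrite -ltnS.
(* Every vertex is an end of a side between successive vertices, where determinant 1 is a Bezout
   relation. *)
have vcop (a : 'I_n.+1) : coprime (v a).1 (v a).2.
  have sideS (b c : 'I_n.+1) : c = b.+1 :> nat -> vdet (v b) (v c) = 1.
    by move=> cb; apply: ve; rewrite ?cb // /edge /polygon_side /= cb eqxx.
  have [an|na] := ltnP a n.
    by have /vdet1_coprime[] := sideS a (Ordinal (an : a.+1 < n.+1)%N) erefl.
  have a1 : (a.-1 < n.+1)%N by have := ltn_ord a; lia.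
  have aE : a = a.-1.+1 :> nat by lia.
  by have /vdet1_coprime[] := sideS (Ordinal a1) a aE.
pose f := [ffun a : 'I_n.+1 => slope_of (v a)].
have fdet a b : sdet (f a) (f b) = - vdet (v a) (v b).
  by rewrite !ffunE sdet_slope_of.
have vdetC a b : vdet (v b) (v a) = - vdet (v a) (v b) by rewrite /vdet; ring.
exists f; split.
- move=> a b fab; have f0 : vdet (v a) (v b) = 0.
    have := fdet a b; rewrite fab fdet => /oppr_inj <-.
    by rewrite /vdet mulrC subrr.
  have [/vpos|/vpos|/val_inj //] := ltngtP a b; first by rewrite f0.
  by rewrite vdetC f0 oppr0.
- move=> A /andP[_ /forall_inP sA] _ _ [a /= aA <-] [b /= bA <-] ab.
  rewrite /slope_iota fdet abszN.
  have /forall_inP /(_ b bA) /implyP eab := sA a aA.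
  have /forall_inP /(_ a aA) /implyP eba := sA b bA.
  have [lt|lt|/val_inj E] := ltngtP a b; last by case: ab; rewrite E.
    by rewrite ve // eab.
  by rewrite vdetC abszN ve // eba.
- move=> a b c /andP[ab bc] _; rewrite /slope_ccw !fdet [vdet (v c) _]vdetC opprK.
  by rewrite mulrNN !mulr_gt0 ?vpos // (ltn_trans ab bc).
Qed.

Lemma slope_coprime (s : slope) : coprimez (snum s) (sden s).
Proof. by case: s => [r|] //=; rewrite coprimezE coprime_num_den. Qed.

Lemma sdet_eq0 (s t : slope) : sdet s t = 0 -> s = t.
Proof.
case: s t => [r|] [q|] //; rewrite /sdet /=.
- move=> /eqP; rewrite subr_eq0 => /eqP E; congr Some.
  by apply/eqP; rewrite rat_eq E mulrC.
- by rewrite mulr0 sub0r mulr1 => /eqP; rewrite oppr_eq0 denq_eq0.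
- by rewrite mul0r subr0 mul1r => /eqP; rewrite denq_eq0.
Qed.

(** Since a labelling exists, [xget] returns one rather than its default. *)
Lemma farey_label_inj n (tau : {set 'I_n * 'I_n}) : (1 < n)%N ->
  tau \in triangulations n -> injective (farey_label tau).
Proof.
move=> n1 tauT; have [f fP] := farey_labelling_exists n1 tauT.
have : farey_labelling tau (farey_label tau).
  by apply: (@xgetPex _ _ [set g | farey_labelling tau g]%classic); exists f.
by case.
Qed.

(** * The sieve of Legendre *)

Definition coprime_count (y b : nat) : nat := \sum_(0 <= x < b) coprime y x.

Definition ndivisors (y : nat) : nat := \sum_(1 <= d < y.+1) (d %| y).

Lemma coprime_countS y b :
  coprime_count y b.+1 = (coprime_count y b + coprime y b)%N.
Proof. by rewrite /coprime_count big_nat_recr. Qed.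

(** Coprimality to [y] is periodic: moving a window of length [y] one step drops [a] and gains
    [a + y]. *)
Lemma coprime_window y a :
  coprime_count y (a + y) = (coprime_count y a + totient y)%N.
Proof.
elim: a => [|a IH].
  by rewrite add0n totient_count_coprime /coprime_count [in RHS]big_geq.
rewrite addSn !coprime_countS IH.
have -> : coprime y (a + y) = coprime y a by rewrite /coprime addnC -{2}[y]mul1n gcdnMDl.
lia.
Qed.

Lemma totient_le y : (totient y <= y)%N.
Proof.
rewrite totient_count_coprime -[leqRHS]card_ord -sum1_card big_mkord.
by apply: leq_sum => i _; case: coprime.
Qed.

Lemma coprime_count_mul y p : coprime_count y (p * y) = (p * totient y)%N.
Proof.
elim: p => [|p IH]; first by rewrite !mul0n /coprime_count big_geq.
by rewrite mulSnr coprime_window IH mulSnr.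
Qed.

Lemma coprime_count_dvd p m b :
  (p %| m)%N -> coprime_count (p * m) b = coprime_count m b.
Proof.
move=> pm; apply: eq_bigr => x _; rewrite coprimeMl.
case cmx: (coprime m x); last by rewrite andbF.
by rewrite (coprime_dvdl pm cmx).
Qed.

(** The numbers below [b] coprime to [m] but not to [p * m] are the [p * x'] with [x'] coprime to
    [m] and below the ceiling of b/p, which is [(b + p.-1) %/ p]. *)
Lemma coprime_count_prime p m b : prime p -> ~~ (p %| m)%N ->
  coprime_count m b =
  (coprime_count (p * m) b + coprime_count m ((b + p.-1) %/ p))%N.
Proof.
move=> pp pm; have p0 := prime_gt0 pp.
elim: b => [|b IH].
  by rewrite add0n divn_small ?prednK // /coprime_count !big_geq.
rewrite !coprime_countS IH addSn -addnS prednK // (divnDr _ (dvdnn p)) divnn p0 addn1.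
have -> : ((b + p.-1) %/ p = b %/ p + ~~ (p %| b))%N.
  have := divnS (b + p.-1) p0; rewrite -addnS prednK // (divnDr _ (dvdnn p)) divnn p0.
  rewrite dvdn_addl //; lia.
rewrite coprimeMl (prime_coprime b pp).
case: (boolP (p %| b)%N) => pb /=; last by rewrite addn1 /= addnAC.
rewrite addn0 coprime_countS.
have -> : coprime m b = coprime m (b %/ p).
  rewrite -{1}(divnK pb) coprimeMr (coprime_sym m p) (prime_coprime m pp).
  by rewrite pm andbT.
by lia.
Qed.

Lemma totient_mul_dvd p m : (p %| m)%N -> totient (p * m) = (p * totient m)%N.
Proof.
move=> pm; rewrite -[LHS]mul1n -coprime_count_mul mul1n.
by rewrite coprime_count_dvd // coprime_count_mul.
Qed.

Lemma ndivisors_card y : (0 < y)%N ->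
  ndivisors y = size [seq d <- index_iota 1 y.+1 | d %| y]%N.
Proof. by move=> y0; rewrite size_filter -sum1_count big_mkcond. Qed.

Lemma ndivisors_mull p m :
  (0 < p)%N -> (0 < m)%N -> (ndivisors m <= ndivisors (p * m))%N.
Proof.
move=> p0 m0; rewrite !ndivisors_card ?muln_gt0 ?p0 //.
apply: uniq_leq_size; first by rewrite filter_uniq ?iota_uniq.
move=> d; rewrite !mem_filter !mem_index_iota => /andP[dm /andP[d0 dlt]].
by rewrite dvdn_mull //= d0 /=; nia.
Qed.

(** The divisors of [m] and their multiples by [p] are distinct divisors of [p * m]. *)
Lemma ndivisors_mul_prime p m : prime p -> (0 < m)%N -> ~~ (p %| m)%N ->
  (2 * ndivisors m <= ndivisors (p * m))%N.
Proof.
move=> pp m0 pm; have p1 := prime_gt1 pp; have p0 := prime_gt0 pp.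
rewrite !ndivisors_card ?muln_gt0 ?p0 //.
set D := [seq d <- _ | _]; set E := [seq d <- _ | _].
have Duniq : uniq D by rewrite filter_uniq ?iota_uniq.
have -> : (2 * size D = size (D ++ map (muln p) D))%N.
  by rewrite size_cat size_map; lia.
apply: uniq_leq_size.
  rewrite cat_uniq Duniq /= map_inj_uniq ?Duniq ?andbT; last first.
    by move=> x y /eqP; rewrite eqn_pmul2l // => /eqP.
  apply/hasPn => _ /mapP[d dD ->]; rewrite mem_filter negb_and; apply/orP; left.
  by apply: contra pm => /(dvdn_trans (dvdn_mulr d (dvdnn p))).
move=> d; rewrite mem_cat => /orP[|/mapP[{}d dD ->]]; last move: dD.
  rewrite !mem_filter !mem_index_iota => /andP[dm /andP[d0 dlt]].
  by rewrite dvdn_mull //= d0 /=; nia.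
rewrite !mem_filter !mem_index_iota => /andP[dm /andP[d0 dlt]].
by rewrite dvdn_pmul2l // dm /= muln_gt0 p0 d0 /= ltnS leq_pmul2l.
Qed.

Lemma ceil_div_width p a b : (0 < p)%N ->
  let w := ((b + p.-1) %/ p - (a + p.-1) %/ p)%N in
  (p * w <= (b - a) + p)%N /\ (b - a <= p * w + p)%N.
Proof.
move=> p0 w; rewrite /w mulnBr ![(p * _)%N]mulnC.
have := divn_eq (a + p.-1) p; have := divn_eq (b + p.-1) p.
have := ltn_pmod (a + p.-1) p0; have := ltn_pmod (b + p.-1) p0.
move: (_ %% p)%N (_ %% p)%N (_ %/ p * p)%N (_ %/ p * p)%N => ra rb qa qb.
by clear w; split; lia.
Qed.

(* Removing a prime p from the modulus subtracts the same count for m = y/p on an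
   interval shrunk by p, which doubles the error; the number of divisors doubles
   as well. *)
Lemma coprime_count_interval (F : realFieldType) y a b :
  (0 < y)%N -> (a <= b)%N ->
  `|(coprime_count y b)%:R - (coprime_count y a)%:R
     - (totient y)%:R / y%:R * (b - a)%:R| <= (ndivisors y)%:R - 1 :> F.
Proof.
elim/ltn_ind: y a b => y IH a b y0 ab.
have [y1|y1] := leqP y 1.
  have -> : y = 1%N by lia.
  have cc c : coprime_count 1 c = c.
    rewrite /coprime_count; under eq_bigr do rewrite coprime1n.
    by rewrite sum1_size size_iota subn0.
  rewrite !cc /ndivisors big_nat1 dvdnn (_ : totient 1 = 1%N) // divr1 mul1r.
  by rewrite natrB // subrr normr0 subrr.
set p := pdiv y; have pp : prime p := pdiv_prime y1.
have p0 := prime_gt0 pp; have p1 := prime_gt1 pp.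
have py : (p %| y)%N := pdiv_dvd y.
set m := (y %/ p)%N.
have ym : y = (p * m)%N by rewrite mulnC divnK.
have m0 : (0 < m)%N by lia.
have my : (m < y)%N by nia.
have pR : p%:R != 0 :> F by rewrite pnatr_eq0; lia.
have mR : m%:R != 0 :> F by rewrite pnatr_eq0; lia.
(* A repeated prime factor changes neither the coprimality condition nor the density phi(y)/y. *)
have [pm|pm] := boolP (p %| m)%N.
  rewrite ym totient_mul_dvd // !coprime_count_dvd //.
  have -> : (p * totient m)%:R / (p * m)%:R = (totient m)%:R / m%:R :> F.
    by rewrite !natrM; field; apply/andP.
  apply: le_trans (IH m my a b m0 ab) _.
  by rewrite lerD2r ler_nat ndivisors_mull.
have tpm : totient (p * m) = (p.-1 * totient m)%N.
  by rewrite totient_coprime ?prime_coprime // totient_prime.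
pose a' := ((a + p.-1) %/ p)%N; pose b' := ((b + p.-1) %/ p)%N.
have ab' : (a' <= b')%N by rewrite leq_div2r // leq_add2r.
have Ha := coprime_count_prime a pp pm; have Hb := coprime_count_prime b pp pm.
rewrite -/a' in Ha; rewrite -/b' in Hb.
have := IH m my a b m0 ab; have := IH m my a' b' m0 ab'.
have := ndivisors_mul_prime pp m0 pm; rewrite -(ler_nat F) natrM -ym.
rewrite {IH} Ha Hb !natrD -ym.
have -> : (totient y)%:R / y%:R = (1 - p%:R^-1) * ((totient m)%:R / m%:R) :> F.
  rewrite ym tpm !natrM -subn1 natrB //; field; exact/andP.
set c := (totient m)%:R / m%:R.
have c0 : 0 <= c by rewrite divr_ge0.
have c1 : c <= 1 by rewrite ler_pdivrMr ?mul1r ?ler_nat ?ltr0n // totient_le.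
have da : `|(b' - a')%:R - p%:R^-1 * (b - a)%:R| <= 1 :> F.
  have pP : 0 < p%:R :> F by rewrite ltr0n.
  have [] := ceil_div_width a b p0; rewrite -/a' -/b'.
  rewrite -!(ler_nat F) !natrD !natrM.
  have -> : (b' - a')%:R - p%:R^-1 * (b - a)%:R =
      p%:R^-1 * (p%:R * (b' - a')%:R - (b - a)%:R) :> F by field.
  rewrite normrM gtr0_norm ?invr_gt0 // ler_pdivrMl // mulr1 ler_norml.
  by move=> u1 u2; apply/andP; split; lra.
move: da; rewrite !natrB // !ler_norml.
set cya := (coprime_count y a)%:R; set cyb := (coprime_count y b)%:R.
set ca := (coprime_count m a')%:R; set cb := (coprime_count m b')%:R.
set q := p%:R^-1.
move=> /andP[d1 d2] dd /andP[h1 h2] /andP[h3 h4].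
have c1' : 0 <= 1 - c by rewrite subr_ge0.
(* The error at [y] is the error of [m] on [a, b), minus that on [a', b'), minus [c] times the
   rounding error b' - a' - (b - a)/p. It is at most 2 (d(m) - 1) + 1 <= d(y) - 1. *)
apply/andP; split; nra.
Qed.

(** * Consecutive Farey denominators *)

Definition farey_pair (h y z : nat) : bool := coprime y z && (h < y + z)%N.

Lemma farey_pairC h y z : farey_pair h y z = farey_pair h z y.
Proof. by rewrite /farey_pair coprime_sym addnC. Qed.

(** The admissible [z] lie in the window from h - y + 1 to h, of length [y], in which phi(y) numbers
    are coprime to [y]. *)
Lemma sum_farey_pair h y : (0 < y <= h)%N ->
  (\sum_(1 <= z < h.+1) farey_pair h y z = totient y)%N.
Proof.
move=> /andP[y0 yh].
rewrite (big_cat_nat (n := (h - y).+1)) //=; try lia.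
rewrite big_nat big1 ?add0n => [|z /andP[z0 zh]]; last first.
  by rewrite /farey_pair [(h < _)%N]ltnNge (_ : (y + z <= h)%N) ?andbF //; lia.
rewrite big_nat (eq_bigr (fun z => coprime y z : nat)) => [|z /andP[z0 zh]]; last first.
  by rewrite /farey_pair (_ : (h < y + z)%N) ?andbT //; lia.
rewrite -big_nat.
have := coprime_window y (h - y).+1.
rewrite /coprime_count (big_cat_nat (n := (h - y).+1)) //=; last by lia.
have -> : ((h - y).+1 + y = h.+1)%N by lia.
by move=> /addnI.
Qed.

(* Consecutive denominators (y, z) in the Farey sequence of order h are exactly
   the coprime y, z <= h with h < y + z, and the gaps 1/(yz) add up to 1. *)
Lemma sum_farey_gaps (F : realFieldType) h : (0 < h)%N ->
  \sum_(1 <= y < h.+1) \sum_(1 <= z < h.+1)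
     (farey_pair h y z)%:R / (y%:R * z%:R) = 1 :> F.
Proof.
elim: h => // -[_ _|h IH _].
  by rewrite !big_nat1 /farey_pair /= mulr1 divr1.
have nz k : (0 < k)%N -> k%:R != 0 :> F by rewrite pnatr_eq0; case: k.
rewrite big_nat_recr //=.
under eq_big_nat do rewrite big_nat_recr //=.
rewrite big_split /= [X in _ + _ + X]big_nat_recr //=.
set c := fun y => (coprime y h.+2)%:R / (y%:R * h.+2%:R) : F.
have -> : \sum_(1 <= y < h.+2) (farey_pair h.+2 y h.+2)%:R / (y%:R * h.+2%:R)
   = \sum_(1 <= y < h.+2) c y :> F.
  apply: eq_big_nat => y /andP[y0 _]; rewrite /farey_pair /c.
  by rewrite (_ : (h.+2 < y + h.+2)%N) ?andbT //; lia.
have -> : \sum_(1 <= z < h.+2) (farey_pair h.+2 h.+2 z)%:R / (h.+2%:R * z%:R)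
   = \sum_(1 <= y < h.+2) c y :> F.
  apply: eq_big_nat => y /andP[y0 _]; rewrite farey_pairC /farey_pair /c mulrC.
  by rewrite (_ : (h.+2 < y + h.+2)%N) ?andbT 1?[_ * y%:R]mulrC 1?mulrC //; lia.
have -> : farey_pair h.+2 h.+2 h.+2 = false by rewrite /farey_pair /coprime gcdnn.
rewrite mul0r addr0.
rewrite -[RHS](IH isT).
(* Raising the order to [h.+2] destroys exactly the pairs with y + z = h + 2. *)
have -> : \sum_(1 <= y < h.+2) \sum_(1 <= z < h.+2)
     (farey_pair h.+1 y z)%:R / (y%:R * z%:R) =
  \sum_(1 <= y < h.+2) \sum_(1 <= z < h.+2)
     (farey_pair h.+2 y z)%:R / (y%:R * z%:R) +
  \sum_(1 <= y < h.+2) (coprime y h.+2)%:R / (y%:R * (h.+2 - y)%:R) :> F.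
  rewrite -big_split /=; apply: eq_big_nat => y /andP[y0 yh].
  have -> : (coprime y h.+2)%:R / (y%:R * (h.+2 - y)%:R) =
     \sum_(1 <= z < h.+2) (if z == (h.+2 - y)%N then
         (coprime y z)%:R / (y%:R * z%:R) else 0) :> F.
    rewrite -big_mkcond big_nat1_eq ifT; last by lia.
    by rewrite /coprime -[X in gcdn y X](subnKC (ltnW yh)) gcdnDl.
  rewrite -big_split /=; apply: eq_big_nat => z /andP[z0 zh].
  rewrite /farey_pair; case: coprime => /=; last by rewrite !mul0r add0r; case: eqP.
  have [zy|zy] := eqVneq z.
    have -> : (h.+1 < y + z)%N by lia.
    have -> : (h.+2 < y + z)%N = false by lia.
    by rewrite mul0r add0r zy.
  by rewrite addr0; have -> : (h.+1 < y + z)%N = (h.+2 < y + z)%N by lia.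
rewrite -addrA; congr (_ + _).
(* The mediant splits each such gap: 1/(yz) = 1/(y(y+z)) + 1/(z(y+z)). *)
have -> : \sum_(1 <= y < h.+2) (coprime y h.+2)%:R / (y%:R * (h.+2 - y)%:R) =
  \sum_(1 <= y < h.+2) (c y + c (h.+2 - y)%N) :> F.
  apply: eq_big_nat => y /andP[y0 yh]; rewrite /c.
  have -> : coprime (h.+2 - y) h.+2 = coprime y h.+2.
    by rewrite -{2 3}[h.+2](subnK (ltnW yh)) /coprime gcdnDl gcdnDr gcdnC.
  have d0 : (0 < h.+2 - y)%N by lia.
  move: (h.+2 - y)%N d0 (subnKC (ltnW yh)) => d d0 <-; rewrite natrD; field.
  by rewrite -natrD !nz //; lia.
rewrite big_split /=; congr (_ + _).
by rewrite big_nat_rev.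
Qed.

Lemma sum_totient_width (F : realFieldType) (k : F) h (al be : nat -> F) :
  (forall y z, (0 < y <= h)%N -> (0 < z <= h)%N -> al y + be z <= k / (y%:R * z%:R)) ->
  (0 < h)%N ->
  \sum_(1 <= y < h.+1) (totient y)%:R * (al y + be y) <= k.
Proof.
move=> H h0.
rewrite -[leRHS]mulr1 -[X in k * X](sum_farey_gaps F h0) mulr_sumr.
under eq_bigr do rewrite mulrDr.
rewrite big_split /=.
have E (g : nat -> F) : \sum_(1 <= y < h.+1) (totient y)%:R * g y =
  \sum_(1 <= y < h.+1) \sum_(1 <= z < h.+1) (farey_pair h y z)%:R * g y.
  apply: eq_big_nat => y /andP[y0 yh].
  by rewrite -(@sum_farey_pair h) ?y0 // natr_sum mulr_suml.
rewrite (E al) (E be) [X in _ + X]exchange_big /= -big_split /= !big_nat.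
apply: ler_sum => y yh; rewrite -big_split mulr_sumr /= !big_nat.
apply: ler_sum => z zh; rewrite [farey_pair h z y]farey_pairC -mulrDr.
case: farey_pair; last by rewrite !mul0r mulr0.
by rewrite !mul1r H.
Qed.

(** * Counting primitive vectors row by row *)

(** The sieve is applied from the least to the greatest value of [x]. This interval has one integer
    more than its width, an excess of phi(y)/y <= 1 that the -1 in the sieve estimate absorbs. *)
Lemma card_coprime_width (F : realFieldType) (T : finType) (A : {set T})
    (x : T -> nat) (y : nat) (w : F) :
  (0 < y)%N -> 0 <= w -> {in A &, injective x} -> {in A, forall i, coprime y (x i)} ->
  {in A &, forall i j, (x i)%:R - (x j)%:R <= y%:R * w} ->
  #|A|%:R <= (totient y)%:R * w + (ndivisors y)%:R.
Proof.
move=> y0 w0 xinj xcop xw.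
have [->|[i0 i0A]] := set_0Vmem A; first by rewrite cards0 addr_ge0 ?mulr_ge0.
case: (arg_minnP x i0A) => i iA imin; case: (arg_maxnP x i0A) => j jA jmax.
have ij : (x i <= x j)%N by apply: imin.
have cA : (#|A| + coprime_count y (x i) <= coprime_count y (x j).+1)%N.
  rewrite /coprime_count [leqRHS](big_cat_nat (n := x i)) //=; last by lia.
  rewrite addnC leq_add2l -big_mkcond sum1_count -size_filter cardE -(size_map x).
  apply: uniq_leq_size.
    by rewrite map_inj_in_uniq ?enum_uniq // => u v; rewrite !mem_enum; apply: xinj.
  move=> _ /mapP[u uA ->]; rewrite mem_enum in uA.
  rewrite mem_filter xcop //= mem_index_iota ltnS; apply/andP.
  by split; [exact: imin|exact: jmax].
have := coprime_count_interval F y0 (leqW ij).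
rewrite ler_norml => /andP[_].
move: cA; rewrite -(ler_nat F) natrD subSn // -[(x j - x i).+1%:R]natr1.
have yP : 0 < y%:R :> F by rewrite ltr0n.
have t0 : (totient y)%:R / y%:R <= 1 :> F.
  by rewrite ler_pdivrMr // mul1r ler_nat totient_le.
have : (totient y)%:R / y%:R * (x j - x i)%:R <= (totient y)%:R * w.
  rewrite -mulrA ler_wpM2l // mulrC ler_pdivrMr // mulrC natrB //; exact: xw.
rewrite mulrDr mulr1; lra.
Qed.

Lemma card_primitive_le (T : finType) (A : {set T}) (x y : T -> nat) (k h : nat) :
  {in A, forall i, (0 < y i <= h)%N} -> {in A, forall i, coprime (y i) (x i)} ->
  {in A &, forall i j, x i * y j = x j * y i -> i = j}%N ->
  {in A &, forall i j, x i * y j <= x j * y i + k}%N ->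
  (#|A| <= k + \sum_(1 <= d < h.+1) ndivisors d)%N.
Proof.
move=> yh xcop xinj xk.
have [->|[i0 i0A]] := set_0Vmem A; first by rewrite cards0.
case: (arg_maxnP y i0A) => t tA tmax.
have /andP[t0 th] := yh t tA.
have y0 i : i \in A -> 0 < (y i)%:R :> rat by move=> /yh; rewrite ltr0n => /andP[].
pose s i : rat := (x i)%:R / (y i)%:R.
have sB i j : i \in A -> j \in A -> s i - s j <= k%:R / ((y i)%:R * (y j)%:R).
  move=> iA jA; have yi := y0 i iA; have yj := y0 j jA.
  rewrite /s ler_pdivlMr ?mulr_gt0 //.
  have -> : ((x i)%:R / (y i)%:R - (x j)%:R / (y j)%:R) * ((y i)%:R * (y j)%:R)
     = (x i * y j)%:R - (x j * y i)%:R :> rat.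
    by rewrite !natrM; field; rewrite !lt0r_neq0.
  by rewrite lerBlDl -natrD ler_nat xk.
(* The slope s t may be added to every row: the vector (y / y t) t lies in the
   symmetric convex hull.  So rows without vectors get al = be = 0. *)
pose al v : rat := \big[Order.max/0]_(i in A | y i == v) (s t - s i).
pose be v : rat := \big[Order.max/0]_(i in A | y i == v) (s i - s t).
have al0 v : 0 <= al v by apply: bigmax_ge_id.
have be0 v : 0 <= be v by apply: bigmax_ge_id.
have ali i : i \in A -> s t - s i <= al (y i).
  by move=> iA; apply: le_bigmax_cond; rewrite iA /=.
have bei i : i \in A -> s i - s t <= be (y i).
  by move=> iA; apply: le_bigmax_cond; rewrite iA /=.
have kle a b c d : (0 < c <= a)%N -> (0 < d <= b)%N ->
    k%:R / (a%:R * b%:R) <= k%:R / (c%:R * d%:R) :> rat.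
  move=> /andP[c0 ca] /andP[d0 db]; rewrite ler_wpM2l // -!natrM.
  rewrite lef_pV2 ?posrE ?ltr0n ?muln_gt0; try lia.
  by rewrite ler_nat leq_mul.
(* Where one of the maxima is its default 0, the bound comes from a comparison with [t], whose
   height is at least [v] and [z]. *)
have albe v z : (0 < v <= y t)%N -> (0 < z <= y t)%N ->
    al v + be z <= k%:R / (v%:R * z%:R).
  move=> vt zt; rewrite [v%:R * _]mulrC -lerBrDr.
  apply: bigmax_le => [|i /andP[iA /eqP yi]].
    rewrite subr_ge0; apply: bigmax_le => [|j /andP[jA /eqP yj]].
      by rewrite divr_ge0 ?mulr_ge0.
    by rewrite (le_trans (sB _ _ jA tA)) // yj kle // leqnn andbT; case/andP: zt.
  rewrite lerBrDr -lerBrDl; apply: bigmax_le => [|j /andP[jA /eqP yj]].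
    by rewrite subr_ge0 (le_trans (sB _ _ tA iA)) // yi kle // leqnn andbT; case/andP: vt.
  rewrite lerBrDl addrC.
  by have := sB j i jA iA; rewrite yi yj; lra.
have := sum_totient_width albe t0.
have cardA : #|A| = (\sum_(1 <= v < (y t).+1) #|[set i in A | y i == v]|)%N.
  under eq_bigr do rewrite -sum1_card.
  under eq_bigr do under eq_bigl do rewrite inE.
  under eq_bigr do rewrite big_mkcondr.
  rewrite exchange_big -sum1_card /=; apply: eq_bigr => i iA.
  under eq_bigr do rewrite eq_sym.
  rewrite -big_mkcond big_nat1_eq; have /andP[-> _] := yh i iA.
  by rewrite ltnS (tmax i iA : (y i <= y t)%N).
have rows : #|A|%:R <= \sum_(1 <= v < (y t).+1)
    ((totient v)%:R * (al v + be v) + (ndivisors v)%:R) :> rat.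
  rewrite cardA natr_sum !big_nat; apply: ler_sum => v /andP[v0 vt].
  apply: (card_coprime_width (x := x) v0).
  - by rewrite addr_ge0.
  - move=> i j; rewrite !inE => /andP[iA /eqP yi] /andP[jA /eqP yj] xij.
    by apply: xinj => //; rewrite yi yj xij.
  - by move=> i; rewrite inE => /andP[iA /eqP <-]; apply: xcop.
  move=> i j; rewrite !inE => /andP[iA /eqP yi] /andP[jA /eqP yj].
  have vP : 0 < v%:R :> rat by rewrite ltr0n.
  have := ali j jA; have := bei i iA; rewrite /s yi yj => h1 h2.
  rewrite mulrC -ler_pdivrMr // mulrBl; lra.
move=> le_k; rewrite -(ler_nat rat) natrD.
apply: le_trans rows _; rewrite big_split /= lerD // natr_sum.
rewrite [leRHS](big_cat_nat (n := (y t).+1)) //= lerDl.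
by apply: sumr_ge0.
Qed.

(** * A height of order the square root of the determinants *)

(** The (m+1)^2 pairs (a, b) with entries in 0..m give at most [k] residues b - a r modulo [k], so
    two distinct pairs collide; [i] and [j] are the differences of their entries. *)
Lemma thue (k m : nat) (r : int) : (0 < k < m.+1 ^ 2)%N ->
  exists i j t : int, [/\ (i != 0) || (j != 0), `|i| <= m%:Z, `|j| <= m%:Z &
    j = i * r + t * k%:Z].
Proof.
case: k => // k km.
have k0 : k.+1%:Z != 0 by [].
pose g (z : 'I_m.+1 * 'I_m.+1) : int := ((z.2%:Z - z.1%:Z * r) %% k.+1%:Z)%Z.
have g0 z : 0 <= g z by apply: modz_ge0.
have gk z : g z < k.+1%:Z by rewrite ltz_pmod.
pose f z : 'I_k.+1 := inord `|g z|%N.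
have : ~~ injectiveb f.
  apply/negP => /injectiveP /leq_card; rewrite card_prod !card_ord.
  by move: km; rewrite -mulnn; lia.
move=> /injectivePn[[a b] [[a' b'] ne /(congr1 val)]].
have gl z : (`|g z| < k.+1)%N by rewrite -ltz_nat gez0_abs.
rewrite /f /= !inordK //.
move=> gE; have : g (a, b) = g (a', b').
  by rewrite -[LHS]gez0_abs // -[RHS]gez0_abs // gE.
move/eqP; rewrite eqz_mod_dvd /= => /dvdzP[t tE].
exists (a%:Z - a'%:Z), (b%:Z - b'%:Z), t.
have := ltn_ord a; have := ltn_ord b; have := ltn_ord a'; have := ltn_ord b'.
split; try lia.
  apply: contraNT ne; rewrite negb_or !negbK !subr_eq0 => /andP[/eqP[aa] /eqP[bb]].
  by apply/eqP; congr (_, _); apply: val_inj.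
Qed.

(** An integral form with values [i] at [u] and [j] at [v] exists once [j] is congruent to [i * r]
    modulo [k], where [r] is the value at [v] of a Bezout form of [u]; Thue's argument makes [i] and
    [j] small. *)
Lemma primitive_small_form (T : Type) (p q : T -> int) (k m : nat) (u v : T) :
  coprimez (p u) (q u) -> (0 < k < m.+1 ^ 2)%N ->
  `|p u * q v - q u * p v| = k%:Z ->
  (forall a b, `|p a * q b - q a * p b| <= k%:Z) ->
  exists e1 e2 : int,
    coprimez e1 e2 /\ forall a, `|e1 * p a + e2 * q a| <= (2 * m)%:Z.
Proof.
move=> /coprimezP[[c1 c2] /= cE] km uv bound.
have [i [j [t [ij im jm jE]]]] := thue (c1 * p v + c2 * q v) km.
have /andP[k0 _] := km.
have [t' t'E] : exists t' : int, t * k%:Z = t' * (p u * q v - q u * p v).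
  rewrite -uv; case: ger0P => _; [by exists t|by exists (- t); ring].
(* [i] times the Bezout form of [u], plus [t'] times the form vanishing at [u]. *)
pose e1 := i * c1 - t' * q u; pose e2 := i * c2 + t' * p u.
have eu : e1 * p u + e2 * q u = i.
  by rewrite -[RHS]mulr1 -cE /e1 /e2; ring.
have ev : e1 * p v + e2 * q v = j by rewrite jE t'E /e1 /e2; ring.
have eB a : `|e1 * p a + e2 * q a| <= (2 * m)%:Z.
  (* Cramer's rule: the coefficients of [i] and [j] are at most [k], and division by the
     determinant, of size [k], leaves at most 2m. *)
  have E : (p u * q v - q u * p v) * (e1 * p a + e2 * q a) =
     (p a * q v - q a * p v) * i + (p u * q a - q u * p a) * j.
    by rewrite -eu -ev; ring.
  have := bound a v; have := bound u a; have := congr1 Num.norm E.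
  rewrite normrM uv => {}E b1 b2.
  have : `|(p a * q v - q a * p v) * i + (p u * q a - q u * p a) * j| <=
     k%:Z * m%:Z + k%:Z * m%:Z.
    by rewrite (le_trans (ler_normD _ _)) // !normrM lerD // ler_pM.
  rewrite -E -mulrDr ler_pM2l ?ltz_nat // => /le_trans; apply; lia.
have [g [d1 [d2 [a [b [g0 d1E d2E ab]]]]]] : exists g d1 d2 a b : int,
    [/\ g != 0, e1 = d1 * g, e2 = d2 * g & a * e1 + b * e2 = g].
  have [a [b ab]] := Bezoutz e1 e2.
  have [d1 d1E] := dvdzP (dvdz_gcdl e1 e2).
  have [d2 d2E] := dvdzP (dvdz_gcdr e1 e2).
  exists (gcdz e1 e2), d1, d2, a, b; split=> //.
  rewrite gcdz_eq0; apply/negP => /andP[/eqP e10 /eqP e20]; move: ij.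
  by rewrite -eu -ev e10 e20 !mul0r addr0 eqxx.
exists d1, d2; split.
  apply/coprimezP; exists (a, b) => /=; apply: (mulIf g0).
  by rewrite mul1r -[RHS]ab d1E d2E; ring.
(* Dividing the form by the nonzero integer [g] cannot enlarge its values. *)
move=> c; apply: le_trans (eB c); rewrite d1E d2E.
have -> : d1 * g * p c + d2 * g * q c = (d1 * p c + d2 * q c) * g by ring.
by rewrite normrM ler_peMr // -gtz0_ge1 normr_gt0.
Qed.

Lemma coprimez_transform (x y p q a b c d : int) :
  p = a * x + b * y -> q = c * x + d * y -> coprimez p q -> coprimez x y.
Proof.
move=> -> -> /coprimezP[[u v] /= E]; apply/coprimezP.
by exists (u * a + v * c, u * b + v * d) => /=; rewrite -E; ring.
Qed.

(** The small form becomes the second coordinate [Y] of a unimodular change of basis. At most one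
    vector has [Y = 0], whence the successor of [k]; the others are counted by height up to
    [2 * m]. *)
Lemma card_slopes_le (T : finType) (p q : T -> int) (k : nat) :
  (forall a, coprimez (p a) (q a)) ->
  (forall a b, p a * q b - q a * p b = 0 -> a = b) ->
  (forall a b, `|p a * q b - q a * p b| <= k%:Z) ->
  (exists a b, `|p a * q b - q a * p b| = k%:Z) -> (0 < k)%N ->
  exists2 m, (m ^ 2 <= k)%N &
    (#|T| <= k.+1 + \sum_(1 <= d < (2 * m).+1) ndivisors d)%N.
Proof.
move=> cop dist bound [u [v uv]] k0.
have [m mk km] : exists2 m, (m ^ 2 <= k)%N & (k < m.+1 ^ 2)%N.
  have P0 : exists m, (m ^ 2 <= k)%N by exists 0%N.
  have Pk m : (m ^ 2 <= k)%N -> (m <= k)%N by move=> h; nia.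
  case: (ex_maxnP P0 Pk) => m mk mmax; exists m => //.
  by rewrite ltnNge; apply/negP => /mmax; rewrite ltnn.
exists m => //.
have k0m : (0 < k < m.+1 ^ 2)%N by rewrite k0.
have [e1 [e2 [/coprimezP[[a' b'] /= ab] eB]]] :=
  primitive_small_form (cop u) k0m uv bound.
pose X a : int := b' * p a - a' * q a.
pose Y a : int := e1 * p a + e2 * q a.
have XY a b : X a * Y b - Y a * X b = p a * q b - q a * p b.
  by rewrite -[RHS]mul1r -ab /X /Y; ring.
have copXY a : coprimez (X a) (Y a).
  apply: (@coprimez_transform _ _ (p a) (q a) e2 a' (- e1) b') (cop a).
    by rewrite -[LHS]mul1r -ab /X /Y; ring.
  by rewrite -[LHS]mul1r -ab /X /Y; ring.
(* The shear X + N Y makes both coordinates nonnegative up to a common sign. *)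
pose N : int := \sum_a `|X a|.
have NX a : `|X a| <= N.
  by rewrite /N (bigD1 a) //= lerDl sumr_ge0.
pose A := [set a | Y a != 0].
pose x a := `|(X a + N * Y a)%R|%N; pose y a := `|Y a|%N.
have xyE a : a \in A -> exists2 s : int, (s = 1 \/ s = -1) &
    (x a)%:Z = s * (X a + N * Y a) /\ (y a)%:Z = s * Y a.
  rewrite inE /x /y => Ya; have := NX a; move: (X a) (Y a) Ya => Xa Ya Ya0 NXa.
  have [Yp|Yn|Y0] := ltrgtP 0 Ya; last by rewrite Y0 eqxx in Ya0.
    exists 1; [by left|rewrite !mul1r !abszE !ger0_norm //; first exact: ltW].
    by nia.
  exists (-1); [by right|rewrite !mulN1r !abszE !ler0_norm //; first exact: ltW].
  by nia.
have xy a b : a \in A -> b \in A -> exists2 s : int, (s = 1 \/ s = -1) &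
    (x a * y b)%N%:Z - (x b * y a)%N%:Z = s * (p a * q b - q a * p b).
  move=> /xyE[s sE [xa ya]] /xyE[t tE [xb yb]].
  exists (s * t); first by case: sE => ->; case: tE => ->; [left|right|right|left].
  by rewrite !PoszM xa xb ya yb -XY; ring.
have AC : (#|~: A| <= 1)%N.
  apply/card_le1_eqP => a b; rewrite !inE !negbK => /eqP Ya /eqP Yb.
  by apply: dist; rewrite -XY Ya Yb mulr0 mul0r subrr.
rewrite -(cardsC A) addnC -addSn -add1n -addnA leq_add // .
apply: (@card_primitive_le _ A x y).
- by move=> a; rewrite inE /y => Ya; rewrite absz_gt0 Ya -lez_nat abszE; apply: eB.
- move=> a /xyE[s sE [xa ya]]; rewrite coprime_sym.
  change (coprimez (x a) (y a)).
  apply: (@coprimez_transform _ _ (X a) (Y a) s (- s * N) 0 s) (copXY a).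
    by rewrite xa ya; case: sE => ->; ring.
  by rewrite xa ya; case: sE => ->; ring.
- move=> a b aA bA xab; apply: dist.
  have [s sE] := xy a b aA bA; rewrite xab subrr.
  by case: sE => ->; lia.
- move=> a b aA bA; have [s sE] := xy a b aA bA; have := bound a b.
  by case: sE => ->; lia.
Qed.

(** * The divisor sum *)

Lemma sum_dvdn d h : (0 < d)%N -> (\sum_(1 <= y < h.+1) (d %| y) = h %/ d)%N.
Proof.
move=> d0; elim: h => [|h IH]; first by rewrite big_geq // div0n.
by rewrite big_nat_recr //= IH divnS // addnC.
Qed.

(** Double counting of the pairs d | y with y <= h. *)
Lemma sum_ndivisors h :
  (\sum_(1 <= y < h.+1) ndivisors y = \sum_(1 <= d < h.+1) h %/ d)%N.
Proof.
transitivity (\sum_(1 <= y < h.+1) \sum_(1 <= d < h.+1) (d %| y))%N.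
  apply: eq_big_nat => y /andP[y0 yh].
  rewrite [RHS](big_cat_nat (n := y.+1)) //=.
  rewrite [X in (_ + X)%N]big_nat [X in (_ + X)%N]big1 ?addn0 //.
  by move=> d /andP[yd _]; rewrite gtnNdvd.
rewrite exchange_big; apply: eq_big_nat => d /andP[d0 _]; exact: sum_dvdn.
Qed.

(** * Logarithmic estimates *)

Lemma ln_ge1BV (R : realType) (x : R) : 0 < x -> 1 - x^-1 <= ln x.
Proof.
move=> x0; have := @le_ln1Dx R (x^-1 - 1).
rewrite (_ : 1 + _ = x^-1) ?lnV ?posrE // => [H|]; last by ring.
have {H} : - ln x <= x^-1 - 1.
  by apply: H; rewrite ltrBrDr addNr invr_gt0.
lra.
Qed.

Lemma harmonic_le_ln (R : realType) h : (0 < h)%N ->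
  \sum_(1 <= d < h.+1) d%:R^-1 <= 1 + ln h%:R :> R.
Proof.
elim: h => // -[_ _|h IH _]; first by rewrite big_nat1 invr1 ln1 addr0.
rewrite big_nat_recr //=; apply: le_trans (lerD (IH isT) (lexx _)) _.
rewrite -addrA lerD2l.
have h1 : 0 < h.+1%:R :> R by rewrite ltr0n.
have h2 : 0 < h.+2%:R :> R by rewrite ltr0n.
(* The new term 1/(h+2) is at most ln((h+2)/(h+1)). *)
have := ln_ge1BV (divr_gt0 h2 h1).
rewrite ln_div ?posrE // invf_div.
have -> : 1 - h.+1%:R / h.+2%:R = h.+2%:R^-1 :> R.
  by rewrite -[X in X - _](divff (lt0r_neq0 h2)) -mulrBl -natrB // subSnn mul1r.
by rewrite lerBrDl.
Qed.

Lemma sum_ndivisors_le (R : realType) h : (0 < h)%N ->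
  (\sum_(1 <= y < h.+1) ndivisors y)%:R <= h%:R * (1 + ln h%:R) :> R.
Proof.
move=> h0; rewrite sum_ndivisors natr_sum.
apply: le_trans (_ : \sum_(1 <= d < h.+1) h%:R * d%:R^-1 <= _); last first.
  by rewrite -mulr_sumr ler_wpM2l // harmonic_le_ln.
rewrite !big_nat; apply: ler_sum => d /andP[d0 _].
rewrite ler_pdivlMr ?ltr0n // -natrM ler_nat; exact: leq_divM.
Qed.

(** With s = sqrt n >= 1 and L = ln n >= 1/2, the divisor sum is at most 2s(2 + L), and 1 + 4s + 2sL
    <= 2sL + 8sL + 2sL gives the constant 12. *)
Lemma sum_ndivisors_sqrt (R : realType) (n m : nat) : (2 < n)%N -> (m ^ 2 <= n)%N ->
  1 + (\sum_(1 <= y < (2 * m).+1) ndivisors y)%:R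
     <= 12 * Num.sqrt n%:R * ln n%:R :> R.
Proof.
move=> n2 mn; have n0 : 0 < n%:R :> R by rewrite ltr0n; lia.
set s := Num.sqrt n%:R; set L := ln n%:R.
have s1 : 1 <= s by rewrite -sqrtr1 ler_sqrt ?ler1n //; lia.
have ln2 : 2^-1 <= ln 2 :> R.
  by have := ln_ge1BV (ltr0n R 2); lra.
have ln2' : ln 2 <= 1 :> R by have := @le_ln1Dx R 1; rewrite -[1 + 1]/2; apply; lra.
have L2 : 2^-1 <= L.
  apply: le_trans ln2 _; rewrite ler_ln ?posrE // (ler_nat R 2); lia.
have [->|m0] := posnP m; first by rewrite muln0 big_geq // addr0; nra.
have := @sum_ndivisors_le R (2 * m)%N; rewrite muln_gt0 m0 => /(_ isT).
have ms : m%:R <= s.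
  by rewrite -(@ler_sqr R) ?nnegrE ?sqrtr_ge0 // sqr_sqrtr // -natrX ler_nat.
have lnm : ln (2 * m)%:R <= 1 + L.
  rewrite natrM lnM ?posrE ?ltr0n //; apply: (lerD ln2').
  have mn' : (m <= n)%N by nia.
  by rewrite /L ler_ln ?posrE ?n0 ?ler_nat ?ltr0n.
have lnm0 : 0 <= ln (2 * m)%:R :> R by rewrite ln_ge0 // ler1n muln_gt0 m0.
move=> /le_trans H.
have : (2 * m)%:R * (1 + ln (2 * m)%:R) <= 2 * s * (2 + L).
  have ms2 : (2 * m)%:R <= 2 * s by rewrite natrM ler_pM2l.
  by apply: ler_pM => //; lra.
have sL : 0 <= s * (L - 2^-1) by rewrite mulr_ge0 //; lra.
move=> /H; lra.
Qed.

(** * The lower bound for [kappa] *)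

Theorem theorem1p2 (R : realType) :
  exists2 C : R, 0 < C &
    forall (n : nat) (tau : {set 'I_n * 'I_n}),
      (3 <= n)%N -> tau \in triangulations n ->
      n%:R - C * Num.sqrt n%:R * ln n%:R <= (kappa tau)%:R.
Proof.
exists 12 => // n tau n3 tauT.
have n1 : (1 < n)%N by lia.
have finj := farey_label_inj n1 tauT.
pose f := farey_label tau.
(* If n <= kappa, the subtracted term only has to be nonnegative. Otherwise kappa < n turns m^2 <=
   kappa into m^2 <= n. *)
have [nk|kn] := leqP n (kappa tau).
  apply: le_trans (_ : n%:R <= _); last by rewrite ler_nat.
  by rewrite gerBl mulr_ge0 ?ln_ge0 ?ler1n ?mulr_ge0 ?sqrtr_ge0 //; lia.
pose row (a : 'I_n) := (\max_(b < n) horoball_iota tau a b)%N.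
have bound a b : (`|sdet (f a) (f b)| <= kappa tau)%N.
  apply: leq_trans (leq_bigmax (F := row) a).
  exact: (leq_bigmax (F := horoball_iota tau a) b).
have attained : exists a b, (`|sdet (f a) (f b)| = kappa tau)%N.
  have cn : (0 < #|'I_n|)%N by rewrite card_ord; lia.
  have [a aE] := @bigop.eq_bigmax 'I_n row cn.
  have [b bE] := @bigop.eq_bigmax 'I_n (horoball_iota tau a) cn.
  by exists a, b; rewrite /kappa aE /row bE.
have dist a b : sdet (f a) (f b) = 0 -> a = b by move/sdet_eq0/finj.
have k0 : (0 < kappa tau)%N.
  have n0 : (0 < n)%N by lia.
  apply: leq_trans (bound (Ordinal n0) (Ordinal n1)); rewrite lt0n absz_eq0.
  by apply/eqP => /dist /(congr1 val).
have cop a : coprimez (snum (f a)) (sden (f a)) by apply: slope_coprime.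
have boundz a b : `|sdet (f a) (f b)| <= (kappa tau)%:Z.
  by rewrite -abszE lez_nat; apply: bound.
have attainedz : exists a b, `|sdet (f a) (f b)| = (kappa tau)%:Z.
  by have [a [b ab]] := attained; exists a, b; rewrite -abszE ab.
have [m mk] := card_slopes_le cop dist boundz attainedz k0.
rewrite card_ord -(ler_nat R) -addn1 !natrD => cardB.
have := sum_ndivisors_sqrt R n3 (leq_trans mk (ltnW kn)); lra.
Qed.
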